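(* Let $\kappa$ be an uncountable cardinal smaller than the continuum $2^{\aleph_0}$. Assume $\mathrm{BA}_{\kappa}$. Then there exist strongly surjective linear orders of cardinality $\kappa$.
   Context: All linear orders are assumed non-empty. A linear order $M$ is strongly surjective if for every linear order $L$ that embeds into $M$ (via an order preserving injection) there is an epimorphism (order preserving surjection) from $M$ onto $L$. For an infinite cardinal $\kappa$, a linear order is $\kappa$-dense if it has no end points and between any two distinct elements there are exactly $\kappa$ elements. For $\kappa$ an infinite cardinal less than the continuum, $\mathrm{BA}_{\kappa}$ is the statement: up to isomorphism, there is a unique $\kappa$-dense suborder of $\mathbb{R}$. *)

(* Defs.v *)
From HB Require Import structures.
From mathcomp Require Import all_boot all_order.
From mathcomp Require Import boolp classical_sets functions cardinality reals.

Set Implicit Arguments.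
Unset Strict Implicit.
Unset Printing Implicit Defensive.

Import Order.TTheory.

Local Open Scope order_scope.
Local Open Scope classical_set_scope.
Local Open Scope card_scope.

(* A linear order is an [orderType] together with the assumption that it is
   inhabited; the choice structure carried by an [orderType] is no restriction
   under the classical axioms of [boolp].  An infinite cardinal kappa is represented by an arbitrary type
   [K] of that cardinality: every notion below depends on [K] only through
   [#=] and [#<=]. *)

Definition suborder d (T : orderType d) (A : set T) : Type := set_type A.

HB.instance Definition _ d (T : orderType d) (A : set T) :=
  SubType.on (suborder A).
HB.instance Definition _ d (T : orderType d) (A : set T) :=
  Choice.on (suborder A).
HB.instance Definition _ d (T : orderType d) (A : set T) :=
  [SubChoice_isSubOrder of suborder A by <: with d].

Definition order_embeds d (L : orderType d) d' (M : orderType d') : Prop :=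
  exists2 f : L -> M, {homo f : x y / x <= y} & injective f.

Definition order_epi d (M : orderType d) d' (L : orderType d') : Prop :=
  exists2 f : M -> L, {homo f : x y / x <= y} & forall y, exists x, f x = y.

Definition order_iso d (L : orderType d) d' (M : orderType d') : Prop :=
  exists2 f : L -> M, {mono f : x y / x <= y} & bijective f.

Definition strongly_surjective d (M : orderType d) : Prop :=
  inhabited M /\
  forall d' (L : orderType d'), inhabited L ->
    order_embeds L M -> order_epi M L.

Definition card_dense (K : Type) d (M : orderType d) : Prop :=
  [/\ inhabited M,
      forall x : M, (exists y, y < x) /\ (exists y, x < y)
    & forall x y : M, x < y -> [set z : M | x < z < y] #= [set: K]].

Definition BA (R : realType) (K : Type) : Prop :=
  exists A : set R, card_dense K (suborder A) /\
    forall B : set R, card_dense K (suborder B) ->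
      order_iso (suborder A) (suborder B).

(* 2 ^ aleph_0 *)
Definition continuum : set (nat -> bool) := setT.

(* Main.v *)
(* The kappa-dense set A of reals given by BA_kappa is itself strongly
   surjective.  Let L embed into A, and pick a countable D in L that meets every
   interval [x, y] with x < y and contains the end points of L, if any.  Replace
   each point of D by a copy of A and keep the other points of L.  The result is
   kappa-dense, because between any two of its points there is an interval of
   some copy of A; and it embeds into the reals, because countably many cuts
   separate its points.  By BA_kappa it is isomorphic to A, so collapsing the
   copies gives an epimorphism from A onto L.

   The required identities kappa * aleph_0 = kappa and |A| = kappa also come from
   BA_kappa: any nonempty open interval of A is kappa-dense, so isomorphic to A. *)
Require Import Defs.
From HB Require Import structures.
From mathcomp Require Import all_boot all_order all_algebra.
From mathcomp Require Import boolp classical_sets functions cardinality reals.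
From mathcomp Require Import lra.

Set Implicit Arguments.
Unset Strict Implicit.
Unset Printing Implicit Defensive.

Import Order.TTheory GRing.Theory Num.Theory.

Local Open Scope order_scope.
Local Open Scope classical_set_scope.
Local Open Scope card_scope.

(** * Transport along order isomorphisms *)

Lemma inj_setT_card_le (T U : Type) (f : T -> U) :
  injective f -> [set: T] #<= [set: U].
Proof.
move=> f_inj; apply: card_le_trans (card_leT (range f)).
have : range f #= [set: T] by apply: inj_card_eq => x y _ _; exact: f_inj.
by rewrite card_eq_le => /andP[].
Qed.

Lemma order_iso_card_eq d (L : orderType d) d' (M : orderType d') :
  order_iso L M -> [set: L] #= [set: M].
Proof.
move=> [f _ [g /can_inj f_inj /can_inj g_inj]].
by rewrite card_eq_le (inj_setT_card_le f_inj) (inj_setT_card_le g_inj).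
Qed.

Lemma order_iso_sym d (L : orderType d) d' (M : orderType d') :
  order_iso L M -> order_iso M L.
Proof.
move=> [f f_mono [g fK gK]]; exists g; last by exists f.
by move=> x y; rewrite -f_mono !gK.
Qed.

Lemma order_iso_trans d (L : orderType d) d' (M : orderType d')
    d'' (N : orderType d'') :
  order_iso L M -> order_iso M N -> order_iso L N.
Proof.
move=> [f f_mono f_bij] [g g_mono g_bij]; exists (g \o f); last exact: bij_comp.
by move=> x y /=; rewrite g_mono f_mono.
Qed.

Lemma order_iso_card_dense (K : Type) d (L : orderType d) d' (M : orderType d') :
  order_iso L M -> card_dense K L -> card_dense K M.
Proof.
move=> [f f_mono [g fK gK]] [[l0] noend dense].
have f_lt : {mono f : x y / x < y} by exact: leW_mono.
split; first by split; exact: f l0.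
  move=> x; have [[y yx] [z xz]] := noend (g x).
  by split; [exists (f y) | exists (f z)]; rewrite -(gK x) f_lt.
move=> x y xy; have gxy : g x < g y by rewrite -f_lt !gK.
apply: card_eq_trans (dense _ _ gxy).
have -> : [set z : M | x < z < y] = f @` [set z : L | g x < z < g y].
  apply/seteqP; split => [z /andP[xz zy]|_ [z /andP[xz zy] <-]] /=.
    by exists (g z); rewrite //= -!f_lt !gK xz zy.
  by rewrite -(gK x) -(gK y) !f_lt xz zy.
by apply: inj_card_eq => a b _ _; exact: can_inj fK _ _.
Qed.

Lemma order_iso_range d (T : orderType d) d' (U : orderType d') (f : T -> U) :
  {homo f : x y / x < y} -> order_iso T (suborder (range f)).
Proof.
move=> f_homo; have f_mono := le_mono f_homo.
pose h x : suborder (range f) := exist _ (f x) (mem_set (imageT f x)).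
have h_mono : {mono h : x y / x <= y}.
  by move=> x y; rewrite -Order.le_val; exact: f_mono.
have h_surj y : exists x, h x = y.
  by have [x _ fx] := set_mem (valP y); exists x; exact: val_inj.
have [g hK] := choice h_surj.
exists h => //; exists g => // x.
exact: (inc_inj h_mono).
Qed.

(** * Self-similarity and cardinality of the set given by [BA] *)

Definition BA_witness (R : realType) (K : Type) (A : set R) : Prop :=
  card_dense K (suborder A) /\
  forall B : set R, card_dense K (suborder B) ->
    order_iso (suborder A) (suborder B).

(** [BA] speaks of sets of reals only; the range of [g] is such a set, and it is isomorphic to
    [T]. *)
Lemma BA_witness_iso (R : realType) (K : Type) (A : set R) d (T : orderType d)
    (g : T -> R) :
  BA_witness K A -> {homo g : x y / x < y} -> card_dense K T ->
  order_iso (suborder A) T.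
Proof.
move=> [_ BA_A] /order_iso_range TB T_dense.
apply: order_iso_trans (order_iso_sym TB).
exact: BA_A (order_iso_card_dense TB T_dense).
Qed.

Lemma card_dense_between (K : Type) d (T : orderType d) (x y : T) :
  inhabited K -> card_dense K T -> x < y -> exists z : T, x < z < y.
Proof.
move=> [k] [_ _ dense] /dense; rewrite card_eq_le => /andP[_ +].
have [->|/set0P[z xzy] _] := eqVneq [set z : T | x < z < y] set0;
  last by exists z.
by rewrite card_le0 => /eqP/seteqP[/(_ k I)].
Qed.

Lemma card_dense_lt (K : Type) d (T : orderType d) :
  card_dense K T -> exists x y : T, x < y.
Proof. by move=> [[x] noend _]; have [_ [y]] := noend x; exists x, y. Qed.

Lemma card_dense_interval (K : Type) d (T : orderType d) (c d0 : T) :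
  inhabited K -> card_dense K T -> c < d0 ->
  card_dense K (suborder [set z : T | c < z < d0]).
Proof.
move=> K_inh T_dense cd; have [_ _ dense] := T_dense.
pose mk z (zP : c < z < d0) : suborder [set z : T | c < z < d0] :=
  exist _ z (mem_set zP).
have bounds (x : suborder [set z : T | c < z < d0]) : c < val x < d0.
  exact: set_mem (valP x).
split.
- by have [z /mk ?] := card_dense_between K_inh T_dense cd.
- move=> x; have /andP[cx xd] := bounds x; split.
    have [z /andP[cz zx]] := card_dense_between K_inh T_dense cx.
    have zP : c < z < d0 by rewrite cz (lt_trans zx).
    by exists (mk z zP); rewrite -lt_val.
  have [z /andP[xz zd]] := card_dense_between K_inh T_dense xd.
  have zP : c < z < d0 by rewrite zd (lt_trans cx).
  by exists (mk z zP); rewrite -lt_val.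
- move=> x y; rewrite -lt_val => /dense; apply: card_eq_trans.
  have /andP[cx _] := bounds x; have /andP[_ yd] := bounds y.
  have -> : [set z : T | val x < z < val y] =
            val @` [set z : suborder _ | x < z < y].
    apply/seteqP; split=> [z /andP[xz zy]|_ [z /andP[xz zy] <-]] /=.
      have zP : c < z < d0 by rewrite (lt_trans cx) ?(lt_trans zy).
      by exists (mk z zP); rewrite //= -!lt_val xz zy.
    by move: xz zy; rewrite -!lt_val /= => -> ->.
  by rewrite card_eq_sym; apply: inj_card_eq => a b _ _; exact: val_inj.
Qed.

Lemma BA_witness_interval (R : realType) (K : Type) (A : set R)
    (c d : suborder A) :
  inhabited K -> BA_witness K A -> c < d ->
  order_iso (suborder A) (suborder [set z : suborder A | c < z < d]).
Proof.
move=> K_inh A_wit cd.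
apply: (@BA_witness_iso R K A _ _ (fun z => val (val z))) => //.
by have [A_dense _] := A_wit; exact: card_dense_interval.
Qed.

(** By density an open interval of [A] has the cardinality of [K], and by uniqueness it is
    isomorphic to all of [A]. *)
Lemma BA_witness_card (R : realType) (K : Type) (A : set R) :
  inhabited K -> BA_witness K A -> [set: suborder A] #= [set: K].
Proof.
move=> K_inh A_wit; have [A_dense _] := A_wit.
have [c [d cd]] := card_dense_lt A_dense; have [_ _ dense] := A_dense.
apply: card_eq_trans (dense _ _ cd); apply: card_eq_trans (card_setT _).
exact: order_iso_card_eq (BA_witness_interval K_inh A_wit cd).
Qed.

(* The injection is (n, x) |-> f1^n (f0 x). *)
Lemma disjoint_copies_countX (T : Type) (f0 f1 : T -> T) (I : countType) :
  injective f0 -> injective f1 -> (forall x y, f0 x <> f1 y) ->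
  [set: I * T] #<= [set: T].
Proof.
move=> f0_inj f1_inj f01.
pose h (p : I * T) := iter (pickle p.1) f1 (f0 p.2).
(* Cancel common applications of [f1]; if one side runs out first, a value of [f0] equals a value of
   [f1]. *)
have iter_inj n m x y :
    iter n f1 (f0 x) = iter m f1 (f0 y) -> n = m /\ x = y.
  elim: n m => [|n IHn] [|m] /=.
  - by move=> /f0_inj.
  - by move=> /f01.
  - by move=> /esym /f01.
  - by move=> /f1_inj /IHn[-> ->].
apply: (@inj_setT_card_le _ _ h) => -[i x] [j y].
by move=> /iter_inj /= [/(pcan_inj pickleK) -> ->].
Qed.

(** The intervals [(c, d)] and [(d, e)] are disjoint and both isomorphic to [A], which yields two
    self-injections of [A] with disjoint ranges. *)
Lemma BA_witness_countX (R : realType) (K : Type) (A : set R) (I : countType) :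
  inhabited K -> BA_witness K A -> [set: I * suborder A] #<= [set: suborder A].
Proof.
move=> K_inh A_wit; have [A_dense _] := A_wit.
have [c [e ce]] := card_dense_lt A_dense.
have [d /andP[cd de]] := card_dense_between K_inh A_dense ce.
have [f0 _ /bij_inj f0_inj] := BA_witness_interval K_inh A_wit cd.
have [f1 _ /bij_inj f1_inj] := BA_witness_interval K_inh A_wit de.
apply: (@disjoint_copies_countX _ (val \o f0) (val \o f1)) => [||x y /= xy].
- by apply: inj_comp f0_inj; exact: val_inj.
- by apply: inj_comp f1_inj; exact: val_inj.
- have /andP[_] := set_mem (valP (f0 x)); have /andP[+ _] := set_mem (valP (f1 y)).
  by move=> dy xd; have := lt_trans xd dy; rewrite /= xy ltxx.
Qed.

(** * Embedding an order with countably many separating cuts into the reals *)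

Local Open Scope ring_scope.

Definition binary_sum (R : realType) (P : set nat) (N : nat) : R :=
  \sum_(n < N) (if `[< P n >] then 2^-1 ^+ n else 0).

(** The series of 2^-n over n in [P]. Distinct sets may share a code, but not if one contains the
    other, and the sets encoded below form a chain. *)
Definition binary_code (R : realType) (P : set nat) : R :=
  sup (range (binary_sum R P)).

Lemma binary_sum_le2 (R : realType) (P : set nat) N : binary_sum R P N <= 2.
Proof.
have pow_ge0 n : 0 <= (2^-1 : R) ^+ n by rewrite exprn_ge0 ?invr_ge0.
(* The sharper bound is the full geometric sum; it makes the induction go through. *)
suff : binary_sum R P N <= 2 - 2 * 2^-1 ^+ N.
  by have := pow_ge0 N; move: (_ ^+ N) (binary_sum _ _ _) => e s; lra.
elim: N => [|N]; first by rewrite /binary_sum big_ord0 expr0; lra.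
rewrite /binary_sum big_ord_recr /= exprS; have := pow_ge0 N.
by case: ifP => _; move: (_ ^+ N) (\sum_(i < N) _) => e s; lra.
Qed.

Lemma binary_sum_nondecreasing (R : realType) (P : set nat) (N M : nat) :
  (N <= M)%N -> binary_sum R P N <= binary_sum R P M.
Proof.
move=> /subnKC <-; elim: (M - N)%N => [|k IHk]; first by rewrite addn0.
rewrite addnS {2}/binary_sum big_ord_recr /= (le_trans IHk) // lerDl.
by case: ifP => // _; rewrite exprn_ge0 ?invr_ge0.
Qed.

Lemma binary_code_lt (R : realType) (P Q : set nat) (m : nat) :
  P `<=` Q -> Q m -> ~ P m -> binary_code R P < binary_code R Q.
Proof.
move=> PQ Qm Pm.
(* A supremum preserves only weak inequalities, so the gap given by the term of index [m] is kept
   through all partial sums. *)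
suff : binary_code R P <= binary_code R Q - 2^-1 ^+ m.
  have : 0 < (2^-1 : R) ^+ m by rewrite exprn_gt0 ?invr_gt0.
  lra.
apply: ge_sup; first by exists (binary_sum R P 0); exists 0%N.
move=> _ [N _ <-]; rewrite lerBrDr.
pose M := maxn N m.+1; have mM : (m < M)%N by rewrite leq_maxr.
apply: (@le_trans _ _ (binary_sum R Q M)); last first.
  apply: ub_le_sup; last by exists M.
  by exists 2 => _ [k _ <-]; exact: binary_sum_le2.
apply: (@le_trans _ _ (binary_sum R P M + 2^-1 ^+ m)).
  by rewrite lerD2r binary_sum_nondecreasing // leq_maxl.
rewrite /binary_sum (bigD1 (Ordinal mM)) //= [leRHS](bigD1 (Ordinal mM)) //=.
rewrite (asboolF Pm) (asboolT Qm) add0r [leRHS]addrC lerD2r.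
apply: ler_sum => n _; case: ifPn => [/asboolP/PQ Qn|_]; first by rewrite asboolT.
by case: ifP => // _; rewrite exprn_ge0 ?invr_ge0.
Qed.

Local Close Scope ring_scope.

(** Encode a point by the indices of the cuts [U i] that contain it: this set grows with the point,
    strictly so by separation. *)
Lemma separable_embeds_real (R : realType) d (T : orderType d) (I : countType)
    (U : I -> set T) :
  (forall i x y, x <= y -> U i x -> U i y) ->
  (forall x y, x < y -> exists2 i, U i y & ~ U i x) ->
  exists g : T -> R, {homo g : x y / x < y}.
Proof.
move=> U_up U_sep.
exists (fun x => binary_code R [set n | exists2 i, pickle i = n & U i x]).
move=> x y xy; have [i Uiy Uix] := U_sep x y xy.
apply: (@binary_code_lt R _ _ (pickle i)); first 1 last.
- by exists i.
- by move=> [j /(pcan_inj pickleK) ->].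
- by move=> n [j jn Ujx]; exists j => //; apply: U_up Ujx; exact: ltW.
Qed.

(** * Countable sets meeting all intervals *)

Lemma rat_between (R : realType) (x y : R) :
  x < y -> exists q : rat, x < ratr q < y.
Proof. by move=> /rat_in_itvoo[q]; rewrite in_itv /=; exists q. Qed.

(** With closed intervals, a jump may be met at either end. The clauses on end points serve to give
    each point outside [D], which is not blown up, points on both sides. *)
Definition meets_intervals d (L : orderType d) (D : set L) : Prop :=
  [/\ forall x y, x < y -> exists2 z, D z & x <= z <= y,
      forall x, (forall y, x <= y) -> D x
    & forall x, (forall y, y <= x) -> D x].

Lemma meets_intervals_notin d (L : orderType d) (D : set L) (x : L) :
  meets_intervals D -> ~ D x -> (exists y, y < x) /\ (exists y, x < y).
Proof.
move=> [_ D_min D_max] Dx; split; apply: contrapT => no_y; apply: Dx.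
  by apply: D_min => y; rewrite leNgt; apply/negP => yx; apply: no_y; exists y.
by apply: D_max => y; rewrite leNgt; apply/negP => xy; apply: no_y; exists y.
Qed.

Lemma countable_meets_intervals (R : realType) d (L : orderType d) (g : L -> R) :
  inhabited L -> {homo g : x y / x < y} ->
  exists (I : countType) (e : I -> L), meets_intervals (range e).
Proof.
move=> [l0] g_homo; have g_mono := leW_mono (le_mono g_homo).
(* Every interval that is not a jump meets a point chosen by some inl (inl _); the
   lower ends of the jumps and the maximum are chosen by inl (inr _). *)
pose S (i : rat * rat + rat + rat) : set L := match i with
  | inl (inl (p, q)) => [set z | ratr p < g z < ratr q]
  | inl (inr q) => [set z | g z < ratr q /\ forall w, g w < ratr q -> w <= z]
  | inr q => [set z | ratr q < g z /\ forall w, ratr q < g w -> z <= w]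
  end.
(* Where [S i] is empty, [xget] returns [l0], a harmless extra point of the range. *)
exists (rat * rat + rat + rat)%type, (fun i => xget l0 (S i)).
have S_range i x : S i x -> (forall y, S i y -> y = x) ->
    range (fun i => xget l0 (S i)) x.
  by move=> Six Si_uniq; exists i => //; apply: xget_unique.
split.
- move=> x y xy; have [[z /andP[xz zy]]|no_z] := pselect (exists z, x < z < y).
    have [p /andP[xp pz]] := rat_between (g_homo _ _ xz).
    have [q /andP[zq qy]] := rat_between (g_homo _ _ zy).
    have /andP[] : S (inl (inl (p, q))) (xget l0 (S (inl (inl (p, q))))).
      by apply: xgetPex; exists z; rewrite /= pz zq.
    set w := xget _ _ => pw wq; exists w; first by exists (inl (inl (p, q))).
    by rewrite !ltW // -g_mono ?(lt_trans xp) ?(lt_trans wq).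
  (* At a jump, a rational [q] between the two images makes [x] the greatest point whose image is
     below [q]. *)
  have [q /andP[xq qy]] := rat_between (g_homo _ _ xy).
  exists x; last by rewrite lexx ltW.
  have Sqx : S (inl (inr q)) x.
    split=> // w wq; rewrite leNgt; apply/negP => xw; apply: no_z; exists w.
    by rewrite xw -g_mono (lt_trans wq).
  apply: (S_range _ _ Sqx) => z [zq z_max]; apply/eqP.
  by rewrite eq_le z_max // andbT; have [_ ->] := Sqx.
- move=> x x_min; have [q /andP[_ qx]] : exists q : rat, (g x - 1 < ratr q < g x)%R.
    by apply: rat_between; rewrite ltrBlDr ltrDl.
  have Sqx : S (inr q) x by split.
  apply: (S_range _ _ Sqx) => z [qz z_min]; apply/eqP.
  by rewrite eq_le z_min // x_min.
- move=> x x_max; have [q /andP[xq _]] : exists q : rat, (g x < ratr q < g x + 1)%R.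
    by apply: rat_between; rewrite ltrDl.
  have Sqx : S (inl (inr q)) x by split.
  apply: (S_range _ _ Sqx) => z [qz z_max]; apply/eqP.
  by rewrite eq_le z_max // x_max.
Qed.

(** * Blowups: density, embedding into the reals, cardinality *)

(* L with each point x of D replaced by the copy {x} * A of A, and each other
   point x by the single point (x, a0). *)
Definition blowup d (L : orderType d) d' (A : orderType d') (D : set L) (a0 : A) :
    set (L *lexi[d] A) :=
  [set p | D p.1 \/ p.2 = a0].

Lemma ltxi_cases d (L : orderType d) d' (A : orderType d') (p q : L *lexi[d] A) :
  reflect (p.1 < q.1 \/ p.1 = q.1 /\ p.2 < q.2) (p < q).
Proof.
rewrite ltEprodlexi; apply: (iffP andP).
  move=> [+ /implyP lt2]; rewrite le_eqVlt => /orP[/eqP e|]; last by left.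
  by right; split=> //; apply: lt2; rewrite e.
move=> [lt1|[-> lt2]]; first by rewrite ltW // leNgt lt1.
by rewrite lexx lt2.
Qed.

(** Any two points enclose a nondegenerate interval of a copy of [A], so at least [K] many points;
    the bound on the whole blowup gives the converse. *)
Lemma blowup_card_dense (K : Type) d (L : orderType d) d' (A : orderType d')
    (D : set L) (a0 : A) :
  inhabited L -> card_dense K A -> meets_intervals D ->
  [set: suborder (blowup D a0)] #<= [set: K] ->
  card_dense K (suborder (blowup D a0)).
Proof.
move=> [l0] A_dense D_meets T_le; have [_ noend dense] := A_dense.
have blowupD x a : D x -> blowup D a0 (x, a) by left.
pose mk p (pP : blowup D a0 p) : suborder (blowup D a0) := exist _ p (mem_set pP).
split.
- by have /mk : blowup D a0 (l0, a0) by right.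
- move=> s; have [Dx|Dx] := pselect (D (val s).1).
    have [[b ba] [c ac]] := noend (val s).2; split.
      by exists (mk _ (blowupD _ b Dx)); rewrite -lt_val; apply/ltxi_cases; right.
    by exists (mk _ (blowupD _ c Dx)); rewrite -lt_val; apply/ltxi_cases; right.
  have [[y yx] [z xz]] := meets_intervals_notin D_meets Dx; split.
    have yP : blowup D a0 (y, a0) by right.
    by exists (mk _ yP); rewrite -lt_val; apply/ltxi_cases; left.
  have zP : blowup D a0 (z, a0) by right.
  by exists (mk _ zP); rewrite -lt_val; apply/ltxi_cases; left.
- move=> s t st; rewrite card_eq_le (card_le_trans (card_leT _) T_le) /=.
  have [z [b [c [Dz bc sb ct]]]] : exists z b c, [/\ D z, b < c,
      (val s : L *lexi[d] A) <= (z, b) & ((z, c) : L *lexi[d] A) <= val t].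
    have sP : blowup D a0 (val s) := set_mem (valP s).
    have tP : blowup D a0 (val t) := set_mem (valP t).
    move: sP tP st; rewrite -lt_val; move: (val s) (val t).
    move=> [x a] [y a'] xa ya' /ltxi_cases /= [xy|[exy aa']].
      have [D_meet _ _] := D_meets; have [z Dz /andP[xz]] := D_meet _ _ xy.
      (* In the copy over [z], take an interval below [a'] if [z = y], and one above [a] if [z < y];
         the latter also covers [z = x]. *)
      rewrite le_eqVlt => /orP[/eqP zy|zy].
        have [[b ba'] _] := noend a'; exists z, b, a'; split=> //.
          by rewrite leEprodlexi /= xz zy leNgt xy.
        by rewrite leEprodlexi /= zy !lexx.
      have [_ [c ac]] := noend a; exists z, a, c; split=> //.
        by rewrite leEprodlexi /= xz lexx implybT.
      by rewrite leEprodlexi /= ltW // leNgt zy.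
    exists x, a, a'; split=> //; last by rewrite leEprodlexi /= exy !lexx.
    (* Were [x] outside [D], both second coordinates would be [a0]. *)
    case: xa => //= ea; case: ya' => /= [|ea']; first by rewrite exy.
    by move: aa'; rewrite ea ea' ltxx.
  pose f a := mk _ (blowupD z a Dz).
  have f_inj : injective f by move=> a a' [].
  have := dense _ _ bc; rewrite card_eq_le => /andP[_ K_le].
  apply: (card_le_trans K_le).
  apply: (@card_le_trans _ _ _ (f @` [set a : A | b < a < c])).
    have : f @` [set a : A | b < a < c] #= [set a : A | b < a < c].
      by apply: inj_card_eq => ? ? _ _; exact: f_inj.
    by rewrite card_eq_le => /andP[].
  apply: subset_card_le => _ [a /andP[ba ac] <-] /=; rewrite -!lt_val.
  by apply/andP; split; [apply: (le_lt_trans sb)|apply: (lt_le_trans _ ct)];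
    apply/ltxi_cases; right.
Qed.

(** Rational cuts of [L] separate different first coordinates, and rational cuts inside each of the
    countably many copies separate the rest. *)
Lemma blowup_embeds_real (R : realType) d (L : orderType d) d' (A : orderType d')
    (I : countType) (e : I -> L) (a0 : A) (g : L -> R) (h : A -> R) :
  {homo g : x y / x < y} -> {homo h : x y / x < y} ->
  exists k : suborder (blowup (range e) a0) -> R, {homo k : x y / x < y}.
Proof.
move=> g_homo h_homo; have g_le := ltW_homo g_homo; have h_le := ltW_homo h_homo.
pose U (i : rat + I * rat) (s : suborder (blowup (range e) a0)) : Prop :=
  match i with
  | inl q => ratr q < g (val s).1
  | inr (i, q) => e i < (val s).1 \/ e i = (val s).1 /\ ratr q < h (val s).2
  end.
apply: (@separable_embeds_real R _ _ (rat + I * rat)%type U).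
  move=> [q|[i q]] s t; rewrite -Order.le_val leEprodlexi => /andP[st /implyP st2] /=.
    by move=> /lt_le_trans; apply; exact: g_le.
  move=> [es|[es qs]]; first by left; exact: lt_le_trans st.
  move: st; rewrite le_eqVlt => /orP[/eqP st|st]; last by left; rewrite es.
  right; split; first by rewrite es.
  by apply: lt_le_trans qs _; apply/h_le/st2; rewrite st.
move=> s t; rewrite -lt_val => /ltxi_cases[st|[st1 st2]].
  have [q /andP[sq qt]] := rat_between (g_homo _ _ st).
  by exists (inl q) => //=; apply/negP; rewrite -leNgt ltW.
have [q /andP[sq qt]] := rat_between (h_homo _ _ st2).
have [[i _ ei]|s0] : blowup (range e) a0 (val s) := set_mem (valP s).
  exists (inr (i, q)) => /=; first by right; rewrite ei.
  rewrite ei ltxx => -[//|[_ qs]].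
  by have := lt_trans sq qs; rewrite ltxx.
have [[i _ ei]|t0] : blowup (range e) a0 (val t) := set_mem (valP t).
  exists (inr (i, q)) => /=; first by right.
  rewrite ei st1 ltxx => -[//|[_ qs]].
  by have := lt_trans sq qs; rewrite ltxx.
by move: st2; rewrite s0 t0 ltxx.
Qed.

(** A point of a copy is coded by an index of the copy and its place there; the others are
    determined by their first coordinate and go through [f] into an extra copy, indexed by
    [None]. *)
Lemma blowup_card_le d (L : orderType d) d' (A : orderType d')
    (I : countType) (e : I -> L) (a0 : A) (f : L -> A) :
  injective f ->
  [set: suborder (blowup (range e) a0)] #<= [set: option I * A].
Proof.
move=> f_inj.
have code (s : suborder (blowup (range e) a0)) : exists c : option I * A,
    if c.1 is Some i then e i = (val s).1 /\ c.2 = (val s).2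
    else (val s).2 = a0 /\ c.2 = f (val s).1.
  have [[i _ ei]|s0] : blowup (range e) a0 (val s) := set_mem (valP s).
    by exists (Some i, (val s).2).
  by exists (None, f (val s).1).
have [c cP] := choice code.
apply: (@inj_setT_card_le _ _ c) => s t cst.
have := cP s; have := cP t; rewrite -cst.
case: (c s) => [[i|] a] /= [t1 t2] [s1 s2]; apply: val_inj.
  by rewrite [LHS]surjective_pairing [RHS]surjective_pairing -s1 -s2 -t1 -t2.
have est : (val s).1 = (val t).1 by apply: f_inj; rewrite -s2 -t2.
by rewrite [LHS]surjective_pairing [RHS]surjective_pairing est s1 t1.
Qed.

Theorem theorem5p13 (R : realType) (K : Type)
    (K_uncountable : ~ countable [set: K])
    (K_le_continuum : [set: K] #<= continuum)
    (K_neq_continuum : [set: K] #!= continuum)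
    (BA_K : BA R K) :
  exists (d : Order.disp_t) (M : orderType d),
    [set: M] #= [set: K] /\ strongly_surjective M.
Proof.
have K_inh : inhabited K.
  apply: contrapT => K_empty; apply: K_uncountable.
  suff -> : [set: K] = set0 by exact: countable0.
  by apply/seteqP; split=> // k _; apply: K_empty.
have [A A_wit] := BA_K; have [A_dense _] := A_wit.
have A_card := BA_witness_card K_inh A_wit; have [[a0] _ _] := A_dense.
exists _, (suborder A); split=> //; split; first by split.
move=> d L L_inh [f f_homo f_inj].
have f_lt : {homo f : x y / x < y} := inj_homo_lt f_inj f_homo.
have val_lt : {homo (val : suborder A -> R) : x y / x < y} by [].
have g_lt : {homo (val \o f) : x y / x < y} by move=> x y /f_lt.
have [I [e e_meets]] := countable_meets_intervals L_inh g_lt.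
have [k k_lt] := blowup_embeds_real e a0 g_lt val_lt.
have T_le : [set: suborder (blowup (range e) a0)] #<= [set: K].
  (* [option I] is countable, so its product with [A] is absorbed by [A]. *)
  apply: card_le_trans (blowup_card_le e a0 f_inj) _.
  apply: card_le_trans (BA_witness_countX _ K_inh A_wit) _.
  by move: A_card; rewrite card_eq_le => /andP[].
have [h h_mono [h' _ hK]] :=
  BA_witness_iso A_wit k_lt (blowup_card_dense L_inh A_dense e_meets T_le).
exists (fun a => (val (h a)).1) => [x y|l].
  by rewrite -h_mono -Order.le_val leEprodlexi => /andP[].
(* [(l, a0)] is in the blowup whether or not [l] is in the range of [e], so the projection is
   onto. *)
have lP : blowup (range e) a0 (l, a0) by right.
by exists (h' (exist _ (l, a0) (mem_set lP))); rewrite hK.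
Qed.
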